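(* Let $X$ be a topological space that has a $\pi$-base $\mathcal{B}$ consisting of clopen sets. Then $Y=(X\times 2\times \prod\mathcal{B})^\kappa$ is h-homogeneous for every infinite cardinal $\kappa$.
   Context: All spaces are assumed to be Tychonoff. Products and powers carry the product topology. A subset of a space is clopen if it is closed and open. A $\pi$-base of a space $X$ is a collection $\mathcal{B}$ of non-empty open subsets of $X$ such that for every non-empty open subset $U$ of $X$ there exists $V\in\mathcal{B}$ with $V\subseteq U$. Here $2=\{0,1\}$ is the two-point discrete space, and $\prod\mathcal{B}=\prod_{B\in\mathcal{B}}B$ is the product of all the members of $\mathcal{B}$, each regarded as a subspace of $X$. A space is h-homogeneous if all of its non-empty clopen subsets (with the subspace topology) are homeomorphic to each other. *)

(* Defs.v *)
(* MathComp-Analysis. *)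
From HB Require Import structures.
From mathcomp Require Import all_boot all_order all_algebra.
From mathcomp Require Import all_classical all_reals all_analysis.

Set Implicit Arguments.
Unset Strict Implicit.
Unset Printing Implicit Defensive.

Local Open Scope classical_set_scope.

(* [completely_regular_space] is stated with uniformities; by
   [uniform_separatorP] it is separation of points from closed sets by
   continuous functions into [0, 1]. *)
Definition tychonoff_space (T : topologicalType) : Prop :=
  completely_regular_space T /\ hausdorff_space T.

Definition pi_base (T : topologicalType) (Bs : set (set T)) : Prop :=
  (forall V, Bs V -> open V /\ V !=set0) /\
  (forall U, open U -> U !=set0 -> exists2 V, Bs V & V `<=` U).

Definition homeomorphic (S T : topologicalType) : Prop :=
  exists (f : S -> T) (g : T -> S),
    [/\ continuous f, continuous g, cancel f g & cancel g f].

Definition h_homogeneous (T : topologicalType) : Prop :=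
  forall C D : set T, clopen C -> clopen D -> C !=set0 -> D !=set0 ->
    homeomorphic (set_type C) (set_type D).

(* Each member of the family occurs exactly once as a factor: the index type
   is the family itself. *)
Definition prod_family (T : topologicalType) (Bs : set (set T)) :
    topologicalType :=
  prod_topology (fun B : set_type Bs => set_type (set_val B)).

(* Main.v *)
Require Import Defs.
From HB Require Import structures.
From mathcomp Require Import all_boot all_order all_algebra.
From mathcomp Require Import all_classical all_reals all_analysis.

(* Up to homeomorphism, Y is a product of factors, each of which is a point,
   2, X or a member of the pi-base, and each kind of factor occurs infinitely
   often.  A box whose finitely many nontrivial sides are themselves of these
   kinds is a product with the same multiplicities, so Y has a pi-base of
   clopen copies of Y.  Let C be a nonempty clopen subset of Y; it contains a
   clopen copy of Y.

   If some sequence of nonempty open sets is locally finite, then there is a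
   disjoint sequence of clopen copies V_n of Y whose union W is clopen, and it
   can be placed inside C.  With E = C \ W, each V_n contains a copy E_n of E,
   and the shift E -> E_0 -> E_1 -> ... shows that C is homeomorphic to W.

   Otherwise every clopen set depends on finitely many coordinates.  Cutting
   C, or Y, in two along a fresh binary coordinate gives C = C + C and
   Y = Y + Y up to homeomorphism.  Since C = Y + E and Y = C + D, it follows
   that C = Y + C and Y = C + Y, hence C = Y. *)

Set Implicit Arguments.
Unset Strict Implicit.
Unset Printing Implicit Defensive.

Local Open Scope classical_set_scope.

(** * Homeomorphisms between open subsets *)

(* [f] and [g] are total, and their values outside [A] and [B] are junk.
   Continuity is that of the total functions at the points of [A] and [B], so
   the notion is only meant for open [A] and [B]. *)
Definition inverse_homeo {S T : topologicalType} (A : set S) (B : set T)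
    (f : S -> T) (g : T -> S) : Prop :=
  [/\ forall x, A x -> B (f x) /\ g (f x) = x,
      forall y, B y -> A (g y) /\ f (g y) = y,
      forall x, A x -> {for x, continuous f} &
      forall y, B y -> {for y, continuous g}].

Definition local_homeo {S T : topologicalType} (A : set S) (B : set T) : Prop :=
  exists f g, inverse_homeo A B f g.

Lemma inverse_homeo_sym (S T : topologicalType) (A : set S) (B : set T) f g :
  inverse_homeo A B f g -> inverse_homeo B A g f.
Proof. by case. Qed.

Lemma local_homeo_sym (S T : topologicalType) (A : set S) (B : set T) :
  local_homeo A B -> local_homeo B A.
Proof. by move=> [f [g /inverse_homeo_sym gf]]; exists g, f. Qed.

Lemma local_homeo_refl (S : topologicalType) (A : set S) : local_homeo A A.
Proof. by exists id, id; split=> // x _; exact: cvg_id. Qed.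

Lemma local_homeo_trans (S T U : topologicalType) (A : set S) (B : set T)
    (C : set U) :
  local_homeo A B -> local_homeo B C -> local_homeo A C.
Proof.
move=> [f [g [fA gB fc gc]]] [f' [g' [fB gC fc' gc']]].
exists (f' \o f), (g \o g'); split=> /=.
- by move=> x /fA[/fB[? e] gf]; split=> //; rewrite e.
- by move=> x /gC[/gB[? e] gf]; split=> //; rewrite e.
- move=> x Ax; apply: continuous_comp; first exact: fc.
  by apply: fc'; have [] := fA _ Ax.
- move=> x Ax; apply: continuous_comp; first exact: gc'.
  by apply: gc; have [] := gC _ Ax.
Qed.

Lemma open_preimage_on (S T : topologicalType) (A : set S) (B : set T)
    (f : S -> T) :
  open A -> open B -> (forall x, A x -> {for x, continuous f}) ->
  open (A `&` f @^-1` B).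
Proof.
rewrite !openE => oA oB fc x [Ax Bfx]; apply: filterI; first exact: oA.
exact: (fc x Ax B (oB _ Bfx)).
Qed.

(** A single map [f] pulls back all pieces of [B], so a partition of [B] into open pieces yields one
    of [A] into homeomorphic open pieces. *)
Lemma local_homeo_pull (S T : topologicalType) (A : set S) (B : set T) :
  open A -> local_homeo A B ->
  exists f : S -> T, [/\ forall x, A x -> B (f x),
    forall B', open B' -> open (A `&` f @^-1` B') &
    forall B', B' `<=` B -> local_homeo (A `&` f @^-1` B') B'].
Proof.
move=> oA [f [g [fA gB fc gc]]]; exists f; split.
- by move=> x /fA[].
- by move=> B' oB'; exact: open_preimage_on.
- move=> B' B'B; exists f, g; split.
  + by move=> x [/fA[? ?]] /=.
  + move=> y /= B'y; have [] := gB _ (B'B _ B'y) => ? e.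
    by split=> //; split=> //=; rewrite e.
  + by move=> x [/fc].
  + by move=> y /B'B/gc.
Qed.

(** * Gluing and absorption along disjoint open sets *)

Definition disjoint_family {I S : Type} (A : I -> set S) : Prop :=
  forall i j x, A i x -> A j x -> i = j.

(** Disjointness makes the chosen index irrelevant, and on the open set [A i] the glued map equals
    [f i], so it inherits continuity there; [d] fills in elsewhere. *)
Lemma glue_fun (S T : topologicalType) (I : Type) (A : I -> set S)
    (f : I -> S -> T) (d : S -> T) :
  (forall i, open (A i)) -> disjoint_family A ->
  (forall i x, A i x -> {for x, continuous (f i)}) ->
  exists F : S -> T, (forall i x, A i x -> F x = f i x) /\
    (forall i x, A i x -> {for x, continuous F}).
Proof.
move=> oA dA fc.
pose F x := if pselect (exists i, A i x) is left h
  then f (projT1 (cid h)) x else d x.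
have FE i x : A i x -> F x = f i x.
  move=> Aix; rewrite /F; case: pselect => [h|[]]; last by exists i.
  by by case: cid => j /= Ajx; rewrite (dA _ _ _ Ajx Aix).
exists F; split=> // i x Aix.
rewrite /prop_for /continuous_at (FE _ _ Aix).
apply: cvg_trans (fc _ _ Aix); apply: near_eq_cvg.
have := oA i; rewrite openE => /(_ _ Aix); apply: filterS => y Aiy.
by rewrite (FE i).
Qed.

Lemma local_homeo_glue (S : topologicalType) (I : Type) (A B : I -> set S) :
  (forall i, open (A i)) -> (forall i, open (B i)) ->
  disjoint_family A -> disjoint_family B ->
  (forall i, local_homeo (A i) (B i)) ->
  local_homeo (\bigcup_i A i) (\bigcup_i B i).
Proof.
move=> oA oB dA dB /choice[f /choice[g fg]].
have [|F [FE Fc]] := @glue_fun S S I A f id oA dA.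
  by move=> i x Aix; have [_ _ + _] := fg i; apply.
have [|G [GE Gc]] := @glue_fun S S I B g id oB dB.
  by move=> i x Aix; have [_ _ _] := fg i; apply.
exists F, G; split.
- move=> x [i _ Aix]; have [/(_ _ Aix)[Bi gfx] _ _ _] := fg i.
  by rewrite (FE i)// (GE i)//; split=> //; exists i.
- move=> x [i _ Aix]; have [_ /(_ _ Aix)[Bi gfx] _ _] := fg i.
  by rewrite (GE i)// (FE i)//; split=> //; exists i.
- by move=> x [i _ /Fc].
- by move=> x [i _ /Gc].
Qed.

Lemma local_homeo_setU (S : topologicalType) (A1 A2 B1 B2 : set S) :
  open A1 -> open A2 -> open B1 -> open B2 ->
  A1 `&` A2 = set0 -> B1 `&` B2 = set0 ->
  local_homeo A1 B1 -> local_homeo A2 B2 ->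
  local_homeo (A1 `|` A2) (B1 `|` B2).
Proof.
move=> oA1 oA2 oB1 oB2 dA dB h1 h2.
have disj (P Q : set S) : P `&` Q = set0 ->
    disjoint_family (fun b : bool => if b then P else Q).
  move=> PQ0 [] [] x //= Px Qx; have : set0 x by rewrite -PQ0.
    by [].
  by have : set0 x by rewrite -PQ0.
have E (P Q : set S) : P `|` Q = \bigcup_(b : bool) (if b then P else Q).
  apply/seteqP; split=> x; first by case=> ?; [exists true|exists false].
  by move=> [[] _ ?]; [left|right].
by rewrite !E; apply: local_homeo_glue; try exact: disj; case.
Qed.

(** Hilbert's hotel: pulling the [V n] back through [V0] gives copies [V' n] of [Y] in [C] with
    union [W]. The remainder [E] moves into [V' 0], and the copy of [E] in each [V' n] moves on to
    [V' n.+1]. *)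
Lemma local_homeo_bigcup_copies (Y : topologicalType) (V : nat -> set Y)
    (C V0 : set Y) :
  (forall n, open (V n)) -> disjoint_family V -> closed (\bigcup_n V n) ->
  (forall n, local_homeo (V n) [set: Y]) ->
  clopen C -> clopen V0 -> V0 `<=` C -> local_homeo V0 [set: Y] ->
  local_homeo C (\bigcup_n V n).
Proof.
move=> oV dV cV Vh [oC cC] [oV0 cV0] V0C /(local_homeo_pull oV0)[f [_ fo fh]].
pose V' n := V0 `&` f @^-1` V n.
pose W := V0 `&` f @^-1` (\bigcup_n V n).
have WE : W = \bigcup_n V' n.
  apply/seteqP; split=> x; first by move=> [? [n _ ?]]; exists n.
  by move=> [n _ [? ?]]; split=> //; exists n.
have oV' n : open (V' n) by exact: fo.
have oW : open W by apply: fo; apply: bigcup_open => n _; exact: oV.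
have V'C n x : V' n x -> C x by move=> [/V0C].
have dV' : disjoint_family V'.
  by move=> i j x [_ Vi] [_ Vj]; exact: (dV i j (f x)) Vi Vj.
pose E := C `&` ~` W.
have EC : E `<=` C by move=> x [].
(* [fo] gives openness only inside [V0], so [E] is split along [V0]; here the union of the [V n] has
   to be closed. *)
have EE : E = (C `&` ~` V0) `|` (V0 `&` f @^-1` (~` \bigcup_n V n)).
  apply/seteqP; split=> x.
    move=> [Cx nWx]; have [V0x|] := pselect (V0 x); last by left.
    by right; split=> // h; apply: nWx.
  by move=> [[Cx nV0x]|[V0x h]]; split=> //;
    [move=> [/nV0x]|exact: V0C|move=> [_ /h]].
have oE : open E.
  rewrite EE; apply: openU; first by apply: openI => //; exact: closed_openC.
  by apply: fo; exact: closed_openC.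
have cE : closed E by apply: closedI => //; exact: open_closedC.
have V'h n : local_homeo (V' n) [set: Y].
  by apply: local_homeo_trans (Vh n); exact: fh.
have /choice[h hP] n := local_homeo_pull (oV' n) (V'h n).
(* The pieces [inl n] of A are E, E_0, E_1, ... and those of B are
   E_0, E_1, ...; the pieces [inr n] are the V'_n \ E_n on both sides. *)
pose A (i : nat + nat) := match i with
  | inl 0%N => E
  | inl n.+1 => V' n `&` h n @^-1` E
  | inr n => V' n `&` h n @^-1` (~` E) end.
pose B (i : nat + nat) := match i with
  | inl n => V' n `&` h n @^-1` E
  | inr n => V' n `&` h n @^-1` (~` E) end.
have oh n b : open (V' n `&` h n @^-1` (if b then E else ~` E)).
  have [_ + _] := hP n; apply; case: b => //; exact: closed_openC.
have EV' n x : E x -> V' n x -> False.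
  by move=> [_ nWx] V'x; apply: nWx; rewrite WE; exists n.
have hE n : local_homeo (V' n `&` h n @^-1` E) E.
  by have [_ _] := hP n; apply.
apply: (@local_homeo_trans _ _ _ _ W); last exact: fh.
have -> : C = \bigcup_i A i.
  apply/seteqP; split=> x.
    move=> Cx; have [|nWx] := pselect (W x); last by exists (inl 0%N).
    rewrite WE => -[n _ V'x]; have [Eh|nEh] := pselect (E (h n x)).
      by exists (inl n.+1).
    by exists (inr n).
  by move=> [[[|n]|n] _ /=]; [exact: EC|move=> [/V'C]|move=> [/V'C]].
have -> : W = \bigcup_i B i.
  rewrite WE; apply/seteqP; split=> x.
    move=> [n _ V'x]; have [Eh|nEh] := pselect (E (h n x)).
      by exists (inl n).
    by exists (inr n).
  by move=> [[n|n] _ [V'x _]]; exists n.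
apply: local_homeo_glue.
- by move=> [[|n]|n] //=; [exact: (oh n true)|exact: (oh n false)].
- by move=> [n|n] //=; [exact: (oh n true)|exact: (oh n false)].
- move=> [[|n]|n] [[|m]|m] x //=.
  + by move=> /EV' + [/[swap] _ V'x] => /(_ _ V'x).
  + by move=> /EV' + [/[swap] _ V'x] => /(_ _ V'x).
  + by move=> [V'x _] /EV'/(_ V'x).
  + by move=> [V'x _] [/(dV' _ _ _ V'x) ->].
  + by move=> [V'x hx] [/(dV' _ _ _ V'x) <-].
  + by move=> [V'x _] /EV'/(_ V'x).
  + by move=> [V'x hx] [/(dV' _ _ _ V'x) <-].
  + by move=> [V'x _] [/(dV' _ _ _ V'x) ->].
- move=> [n|n] [m|m] x /= [V'x hx] [/(dV' _ _ _ V'x) <-] //.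
- move=> [[|n]|n] /=.
  + exact/local_homeo_sym/hE.
  + exact/(local_homeo_trans (hE _))/local_homeo_sym/hE.
  + exact: local_homeo_refl.
Qed.

(** Let Q be the complement of [P], and split [V] into copies of P and Q. The Q-part together with C
    \ V is a copy of C, hence of C ∩ P. The P-part is a copy of Y = C + (Y \ C), hence of (C \ P) +
    (Y \ C). The targets add up to Y. *)
Lemma local_homeo_absorb (Y : topologicalType) (P C V : set Y) :
  clopen P -> local_homeo P [set: Y] -> local_homeo (~` P) [set: Y] ->
  clopen C -> local_homeo C (C `&` P) -> local_homeo C (C `&` ~` P) ->
  clopen V -> V `<=` C -> local_homeo V [set: Y] ->
  local_homeo C [set: Y].
Proof.
move=> [oP cP] Ph Qh [oC cC] CP CQ [oV cV] VC Vh.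
have oQ : open (~` P) by exact: closed_openC.
have onC : open (~` C) by exact: closed_openC.
have [f [_ fo fh]] := local_homeo_pull oV Vh.
have oCV : open (C `&` ~` V) by apply: openI => //; exact: closed_openC.
have V2 : local_homeo ((V `&` f @^-1` (~` P)) `|` (C `&` ~` V)) (C `&` P).
  apply: local_homeo_trans CP.
  rewrite [X in local_homeo _ X](_ : C = V `|` (C `&` ~` V)).
    apply: local_homeo_setU => //.
    - exact: fo.
    - by rewrite -subset0 => x [[Vx _] [_ nVx]].
    - by rewrite -subset0 => x [Vx [_ nVx]].
    - apply: (local_homeo_trans (fh _ _)) => //.
      exact: (local_homeo_trans Qh (local_homeo_sym Vh)).
    - exact: local_homeo_refl.
  apply/seteqP; split=> x; last by move=> [/VC|[]].
  by move=> Cx; have [|] := pselect (V x); [left|right].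
have V1 : local_homeo (V `&` f @^-1` P) ((C `&` ~` P) `|` ~` C).
  apply: (local_homeo_trans (fh _ _)) => //; apply: (local_homeo_trans Ph).
  rewrite -[X in local_homeo X _](setUv C).
  apply: local_homeo_setU => //.
  - exact: openI.
  - exact: setICr.
  - by rewrite -subset0 => x [[]].
  - exact: local_homeo_refl.
have -> : C = (V `&` f @^-1` P) `|` ((V `&` f @^-1` (~` P)) `|` (C `&` ~` V)).
  apply/seteqP; split=> x; last by move=> [[/VC]|[[/VC]|[]]].
  move=> Cx; have [Vx|nVx] := pselect (V x); last by right; right.
  by have [Pf|nPf] := pselect (P (f x)); [left|right; left].
have -> : [set: Y] = ((C `&` ~` P) `|` ~` C) `|` (C `&` P).
  apply/seteqP; split=> x // _.
  have [Cx|nCx] := pselect (C x); last by left; right.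
  by have [Px|nPx] := pselect (P x); [right|left; left].
apply: local_homeo_setU => //.
- exact: fo.
- by apply: openU => //; exact: fo.
- by apply: openU => //; exact: openI.
- exact: openI.
- by rewrite -subset0 => x [[Vx Px] [[_ nPx]|[_ nVx]]]; [apply: nPx|].
- by rewrite -subset0 => x [[[_ nPx]|nCx] [Cx Px]].
Qed.

(** * The product topology *)

Lemma filter_finite_forall (T J : Type) (F : set_system T) (G : set J)
    (P : J -> set T) :
  Filter F -> finite_set G -> (forall j, G j -> F (P j)) ->
  F [set x | forall j, G j -> P j x].
Proof.
move=> FF fG FP.
have [s sE] := (@finite_fsetP {classic J} G).1 fG.
rewrite sE; apply: (@filter_bigI T {classic J} s P) => j js.
by apply: FP; rewrite sE.
Qed.

Lemma prod_cvg (J : Type) (T : J -> topologicalType)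
    (F : set_system (prod_topology T)) (x : prod_topology T) :
  Filter F -> (forall j, (fun y : prod_topology T => y j) @ F --> x j) ->
  F --> x.
Proof.
move=> FF Fx; apply/cvg_sup => j A [_ [[B oB <-] Bx] BA].
by apply: filterS BA _; apply: (Fx j); exact: open_nbhs_nbhs.
Qed.

Lemma prod_coord_continuous (J : Type) (T : J -> topologicalType) (j : J) :
  continuous (fun y : prod_topology T => y j).
Proof. exact: (@proj_continuous {classic J} T j). Qed.

Lemma nbhs_box (J : Type) (T : J -> topologicalType) (x : prod_topology T)
    (G : set J) (O : forall j, set (T j)) :
  finite_set G -> (forall j, G j -> nbhs (x j) (O j)) ->
  nbhs x [set y | forall j, G j -> O j (y j)].
Proof.
move=> fG Ox.
apply: (@filter_finite_forall _ _ _ G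
  (fun j => [set y : prod_topology T | O j (y j)])) => // j Gj.
exact: (@prod_coord_continuous J T j x _ (Ox j Gj)).
Qed.

(** The sets containing a box around [x] form a filter converging to [x] in each coordinate, hence
    converging to [x]. *)
Lemma nbhs_sub_box (J : Type) (T : J -> topologicalType) (x : prod_topology T)
    (U : set (prod_topology T)) :
  nbhs x U -> exists (G : set J) (O : forall j, set (T j)),
    [/\ finite_set G, forall j, open (O j), forall j, O j (x j) &
        [set y | forall j, G j -> O j (y j)] `<=` U].
Proof.
pose F : set_system (prod_topology T) := fun V =>
  exists (G : set J) (O : forall j, set (T j)),
    [/\ finite_set G, forall j, open (O j), forall j, O j (x j) &
        [set y | forall j, G j -> O j (y j)] `<=` V].
have FF : Filter F.
  split.
  - exists set0, (fun j => setT); split=> // j; exact: openT.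
  - move=> A B [G [ O [fG oO Ox OA]]] [H [Q [fH oQ Qx QB]]].
    exists (G `|` H), (fun j => O j `&` Q j); split.
    + by rewrite finite_setU.
    + by move=> j; exact: openI.
    + by [].
    + by move=> y yO; split; [apply: OA|apply: QB] => j Gj;
        [have [] := yO j (or_introl Gj)|have [] := yO j (or_intror Gj)].
  - by move=> A B AB [G [ O [fG oO Ox OA]]]; exists G, O; split=> // y /OA/AB.
suff Fx : F --> x by exact: (Fx U).
apply: prod_cvg => j A; rewrite nbhsE => -[B [oB Bx] BA].
pose O := @dfwith {classic J} (fun j => set (T j)) (fun=> setT) j B.
have OP (P : forall k, set (T k) -> Prop) :
    P j B -> (forall k, P k setT) -> forall k, P k (O k).
  move=> PB PT k; rewrite /O; have [<-|jk] := pselect (j = k).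
    by rewrite dfwithin.
  by rewrite dfwithout//; apply/eqP.
exists [set j], O; split.
- exact: finite_set1.
- apply: (OP (fun k (V : set (T k)) => open V)) => // k; exact: openT.
- exact: (OP (fun k (V : set (T k)) => V (x k))).
- by move=> y /(_ j erefl); rewrite /O dfwithin => /BA.
Qed.

Lemma dep_choice (X : Type) (Y : X -> Type) (P : forall x, Y x -> Prop) :
  (forall x, exists y, P x y) -> exists f : forall x, Y x, forall x, P x (f x).
Proof.
by move=> PY; exists (fun x => projT1 (cid (PY x))) => x; case: cid.
Qed.

Definition depends_on (J : Type) (T : J -> Type) (G : set J)
    (C : set (prod_topology T)) : Prop :=
  forall x y, (forall j, G j -> x j = y j) -> C x -> C y.

(** Coordinate [s j] is carried onto the side [A j] of coordinate [j], while the coordinates in [G],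
    which decide membership in [C], keep their values. That condition is phrased through points [y]
    because [T (s j)] and [T j] need not be convertible. *)
Lemma local_homeo_reindex (J : Type) (T : J -> topologicalType)
    (s t : J -> J) (A : forall j, set (T j)) (G : set J)
    (C : set (prod_topology T)) :
  cancel s t -> cancel t s ->
  (forall j, exists f g, inverse_homeo [set: T (s j)] (A j) f g /\
    (G j -> forall y : prod_topology T, f (y (s j)) = y j)) ->
  depends_on G C ->
  local_homeo C (C `&` [set y | forall j, A j (y j)]).
Proof.
move=> sK tK /dep_choice[f /dep_choice[g fg]] GC.
pose h (y : prod_topology T) : prod_topology T := fun j => f j (y (s j)).
(* [g (t j)] lands in [T (s (t j))], hence the cast; [kE] removes it at coordinates of the form
   [s j], and every coordinate has this form. *)
pose k (z : prod_topology T) : prod_topology T :=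
  fun j => ecast i (T i) (tK j) (g (t j) (z (t j))).
have fA j x : A j (f j x) /\ g j (f j x) = x.
  by have [[+ _ _ _] _] := fg j; apply.
have gA j x : A j x -> f j (g j x) = x.
  by have [[_ + _ _] _] := fg j => /[apply] -[].
have kE z j : k z (s j) = g j (z j).
  rewrite /k; move: (tK (s j)); rewrite sK => e.
  by rewrite (Prop_irrelevance e erefl).
have kh y : k (h y) = y.
  apply: functional_extensionality_dep => j; rewrite -(tK j) kE /h.
  by have [] := fA (t j) (y (s (t j))).
have hk z : (forall j, A j (z j)) -> h (k z) = z.
  by move=> Az; apply: functional_extensionality_dep => j; rewrite /h kE gA.
have hG y j : G j -> h y j = y j.
  by move=> Gj; have [_ /(_ Gj)] := fg j; apply.
exists h, k; split.
- move=> y Cy; split; last exact: kh.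
  split; last by move=> j; have [] := fA j (y (s j)).
  by apply: GC Cy => j /hG ->.
- move=> z [Cz Az]; split; last exact: hk.
  by apply: GC Cz => j Gj; rewrite -{1}(hk _ Az) hG.
- move=> y _; apply: (@prod_cvg _ _ _ _ (fmap_filter _ (@nbhs_filter _ _)))
    => j.
  apply: (@continuous_comp _ _ _ (fun y : prod_topology T => y (s j)) (f j)).
    exact: (@prod_coord_continuous J T (s j) y).
  by have [[_ _ fc _] _] := fg j; exact: (fc (y (s j))).
- move=> z [_ Az]; apply: (@prod_cvg _ _ _ _ (fmap_filter _ (@nbhs_filter _ _)))
    => j.
  have ecast_cont i (e : i = j) : continuous (fun a : T i => ecast i (T i) e a).
    by case: _ / e => a; exact: cvg_id.
  have gc : {for z, continuous
      (fun z : prod_topology T => g (t j) (z (t j)))}.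
    apply: (@continuous_comp _ _ _ (fun z : prod_topology T => z (t j))).
      exact: (@prod_coord_continuous J T (t j) z).
    by have [[_ _ _ gc] _] := fg (t j); exact: (gc (z (t j))).
  exact: (@continuous_comp _ _ _ _ (fun a => ecast i (T i) (tK j) a) z gc
    (ecast_cont _ (tK j) _)).
Qed.

(** * Relabelling an index set *)

(** Only a countably infinite subset [N] of [A] has to move: it absorbs the points of [F] outside
    [A], and the rest of [A] is common to both sides. *)
Lemma card_setU_finite (T : Type) (A F : set T) :
  infinite_set A -> finite_set F -> (A #= A `|` F)%card.
Proof.
elim/Ppointed: T => T in A F *; first by rewrite !emptyE.
move=> /infiniteP/card_subP[N Nnat NA] Ffin.
have cU : countable (N `|` (F `\` A)).
  rewrite -bigcup2E; apply: bigcup_countable => // -[|[|n]] _ //=.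
    by rewrite (eq_countable Nnat).
  exact/finite_set_countable/(sub_finite_set _ Ffin).
have Ninf : infinite_set N.
  by rewrite (eq_finite_set Nnat); exact: infinite_nat.
have NU : (N #= N `|` (F `\` A))%card.
  apply: (card_eq_trans Nnat); rewrite card_eq_sym; apply: eq_card_nat => //.
  exact: (sub_infinite_set (@subsetUl _ _ _)).
have /pcard_eqP[f] := NU.
have [|||g _] := @super_bij _ _ _ A _ (A `|` F) f => //.
- by move=> x [/NA|[]]; [left|right].
- suff -> : (A `|` F) `\` (N `|` F `\` A) = A `\` N by [].
  apply/seteqP; split=> x.
    move=> [AFx nNFx]; split; last by move=> Nx; apply: nNFx; left.
    apply: contrapT => nAx; case: AFx => // Fx; apply: nNFx; right.
    by split.
  by move=> [Ax nNx]; split; [left|move=> [|[]]].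
- exact: pcard_eq g.
Qed.

Lemma card_eq_inverse (T : Type) (P Q : set T) : (P #= Q)%card ->
  exists f g : T -> T, (forall x, P x -> Q (f x) /\ g (f x) = x) /\
    (forall y, Q y -> P (g y) /\ f (g y) = y).
Proof.
elim/Ppointed: T => T in P Q *.
  by exists id, id; split=> x; have := no x.
move=> /card_set_bijP[f [fPQ finj fsurj]].
have /choice[g gP] y : exists x, Q y -> P x /\ f x = y.
  have [Qy|nQy] := pselect (Q y); last by exists y.
  by have [x Px <-] := fsurj y Qy; exists x.
exists f, g; split; last by move=> y /gP.
move=> x Px; have Qfx : Q (f x) by exact: fPQ.
by split=> //; have [Pg fg] := gP _ Qfx; apply: finj => //; exact: mem_set.
Qed.

(* The fibres of [c] and [c'] outside [G] are infinite and differ by finite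
   sets, hence are equipotent. *)
Lemma relabel (J I : Type) (c c' : J -> I) (G : set J) :
  (forall i, infinite_set [set j | c j = i]) ->
  finite_set [set j | c' j <> c j] -> finite_set G ->
  (forall j, G j -> c' j = c j) ->
  exists s t : J -> J, [/\ cancel s t, cancel t s,
    forall j, c (s j) = c' j & forall j, G j -> s j = j].
Proof.
move=> cinf Dfin Gfin Gc.
pose P i := [set j | c' j = i] `\` G.
pose Q i := [set j | c j = i] `\` G.
have PQ i : (P i #= Q i)%card.
  pose D := [set j | c' j <> c j].
  have QDinf : infinite_set (Q i `\` D).
    by apply: infinite_setD => //; exact: infinite_setD.
  have QE : Q i = (Q i `\` D) `|` (Q i `&` D) by rewrite setUC setUIDK.
  have PE : P i = (Q i `\` D) `|` (P i `&` D).
    apply/seteqP; split=> j.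
      move=> Pj; have [?|/contrapT e] := pselect (D j); first by right.
      by case: Pj => cj nGj; left; split=> //; split=> //=; rewrite -e.
    by move=> [[[cj nGj] /contrapT e]|[]//]; split=> //=; rewrite e.
  have fin X : finite_set (X `&` D).
    exact: (sub_finite_set (@subIsetr _ _ _)).
  have := card_setU_finite QDinf (fin (P i)); rewrite -PE.
  have := card_setU_finite QDinf (fin (Q i)); rewrite -QE card_eq_sym.
  by move=> QQD QDP; rewrite card_eq_sym; exact: card_eq_trans QQD QDP.
have /choice[f /choice[g fg]] i := card_eq_inverse (PQ i).
(* The fibrewise bijections glue to a permutation, since [f i] takes the fibre of [c'] over [i] to
   that of [c]; points of [G] stay fixed. *)
pose s j := if pselect (G j) then j else f (c' j) j.
pose t j := if pselect (G j) then j else g (c j) j.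
have fP j : ~ G j -> Q (c' j) (f (c' j) j) /\ g (c' j) (f (c' j) j) = j.
  by move=> nGj; have [+ _] := fg (c' j); apply.
have gQ j : ~ G j -> P (c j) (g (c j) j) /\ f (c j) (g (c j) j) = j.
  by move=> nGj; have [_ +] := fg (c j); apply.
exists s, t; split=> j.
- rewrite /s; case: (pselect (G j)) => Gj.
    by rewrite /t; case: (pselect (G j)).
  have [[/= cE nGf] gf] := fP j Gj.
  rewrite /t; case: (pselect (G (f (c' j) j))) => //= _; by rewrite cE.
- rewrite /t; case: (pselect (G j)) => Gj.
    by rewrite /s; case: (pselect (G j)).
  have [[/= cE nGg] gg] := gQ j Gj.
  rewrite /s; case: (pselect (G (g (c j) j))) => //= _; by rewrite cE.
- rewrite /s; case: (pselect (G j)) => Gj; first by rewrite Gc.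
  by have [[]] := fP j Gj.
- by rewrite /s; case: (pselect (G j)).
Qed.

(** * Clopen subsets of a product of labelled factors *)

(** Giving each [j] in [S] the label of a factor homeomorphic to [A j] changes finitely many labels,
    so [relabel] realises the new labelling by a permutation fixing [G]. *)
Lemma local_homeo_box (J I : Type) (lab : J -> I) (T : I -> topologicalType)
    (S G : set J) (A : forall j, set (T (lab j)))
    (C : set (prod_topology (fun j => T (lab j)))) :
  (forall i, infinite_set [set j | lab j = i]) ->
  finite_set S -> finite_set G -> (forall j, G j -> ~ S j) ->
  (forall j, ~ S j -> A j = setT) ->
  (forall j, S j -> exists i, local_homeo [set: T i] (A j)) ->
  depends_on G C ->
  local_homeo C (C `&` [set y | forall j, A j (y j)]).
Proof.
move=> labinf Sfin Gfin GS AT Ah GC.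
have /choice[c cP] j : exists i,
    local_homeo [set: T i] (A j) /\ (~ S j -> i = lab j).
  have [Sj|nSj] := pselect (S j).
    by have [i hi] := Ah j Sj; exists i.
  by exists (lab j); split=> //; rewrite AT//; exact: local_homeo_refl.
have [|||s [t [sK tK ls Gs]]] := @relabel J I lab c G labinf.
- apply: sub_finite_set Sfin => j /= cj; apply: contrapT => nSj.
  by apply: cj; have [_ ->] := cP j.
- by [].
- by move=> j /GS nSj; have [_ ->] := cP j.
apply: (local_homeo_reindex sK tK) GC => j.
have [Gj|nGj] := pselect (G j).
  rewrite (AT _ (GS _ Gj)); move: (Gs j Gj); move: (s j) => j' ->.
  by exists id, id; do !split=> //; move=> x _; exact: cvg_id.
have [+ _] := cP j; rewrite -(ls j) => -[f [g fg]].
by exists f, g.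
Qed.

(** A box with one nontrivial side. Used for a clopen [P] and for its complement, it cuts [C] into
    two copies of itself. *)
Lemma local_homeo_half (J I : Type) (lab : J -> I) (T : I -> topologicalType)
    (G : set J) (j : J) (P : set (T (lab j))) (i : I)
    (C : set (prod_topology (fun j => T (lab j)))) :
  (forall i, infinite_set [set j | lab j = i]) ->
  finite_set G -> ~ G j -> local_homeo [set: T i] P -> depends_on G C ->
  local_homeo C (C `&` [set y | P (y j)]).
Proof.
move=> labinf Gfin nGj Ph GC.
pose A := @dfwith {classic J} (fun j => set (T (lab j))) (fun=> setT) j P.
have Aj : A j = P by exact: dfwithin.
have AT k : j <> k -> A k = setT by move=> jk; apply: dfwithout; exact/eqP.
rewrite (_ : [set y | _] = [set y | forall j, A j (y j)]).
  apply: (@local_homeo_box J I lab T [set j] G A C) => //.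
  - by move=> k Gk /= kj; apply: nGj; rewrite -kj.
  - by move=> k /= kj; apply: AT => /esym.
  - by move=> k /= ->; exists i; rewrite Aj.
apply/seteqP; split=> y /=; last by move=> /(_ j); rewrite Aj.
move=> Py k; have [<-|jk] := pselect (j = k); first by rewrite Aj.
by rewrite AT.
Qed.

(** The sides of a basic box in [U] are shrunk to copies of factors; [local_homeo_box] is then
    applied to the whole space, which depends on no coordinate. *)
Lemma clopen_copy (J I : Type) (lab : J -> I) (T : I -> topologicalType) :
  let Y := prod_topology (fun j => T (lab j)) in
  (forall i, infinite_set [set j | lab j = i]) ->
  (forall i (U : set (T i)), open U -> U !=set0 -> exists A i',
    [/\ clopen A, A `<=` U & local_homeo [set: T i'] A]) ->
  forall U : set Y, open U -> U !=set0 ->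
  exists V : set Y, [/\ clopen V, V `<=` U & local_homeo V [set: Y]].
Proof.
move=> Y labinf TP U oU [y Uy].
have [G [ O [Gfin oO Oy OU]]] := nbhs_sub_box (open_nbhs_nbhs (conj oU Uy)).
have /dep_choice[A AP] j : exists A : set (T (lab j)), [/\ clopen A,
    ~ G j -> A = setT, G j -> A `<=` O j &
    exists i, local_homeo [set: T i] A].
  have [Gj|nGj] := pselect (G j).
    have [|A [i [cA AO Ah]]] := TP (lab j) (O j) (oO j).
      by exists (y j).
    by exists A; split=> //; exists i.
  exists setT; split=> //; first exact: clopenT.
  by exists (lab j); exact: local_homeo_refl.
exists [set y | forall j, A j (y j)].
(* The finite form of the box shows that it is open, the form over all coordinates that it is
   closed. *)
have AE : [set y : Y | forall j, A j (y j)] =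
    [set y : Y | forall j, G j -> A j (y j)].
  apply/seteqP; split=> z /= zA j; first by move=> _; exact: zA.
  have [/zA//|nGj] := pselect (G j).
  by have [_ /(_ nGj) -> _ _] := AP j.
split.
- split.
    rewrite AE openE => z zA; apply: nbhs_box => // j Gj.
    have [[oA _] _ _ _] := AP j; apply: open_nbhs_nbhs; split=> //.
    exact: zA.
  rewrite (_ : mkset _ = \bigcap_j [set z : Y | A j (z j)]); last first.
    by apply/seteqP; split=> z zA j;
      [move=> _; exact: zA|exact: (zA j Logic.I)].
  apply: closed_bigI => j _.
  have [[_ cA] _ _ _] := AP j.
  by apply: closed_comp cA => z _; exact: (@prod_coord_continuous J _ j z).
- move=> z zA; apply: OU => j Gj; have [_ _ + _] := AP j.
  by move=> /(_ Gj); apply; exact: zA.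
- apply: local_homeo_sym.
  rewrite -[X in local_homeo _ X]setTI.
  apply: (@local_homeo_box J I lab T G set0 A setT) => //.
  + by move=> j; have [] := AP j.
  + by move=> j; have [] := AP j.
Qed.

(* Otherwise, one builds finite sets G_0 <= G_1 <= ... of coordinates and boxes
   U_n in C and U'_n outside C, both supported by G_(n+1) and with equal sides
   along G_n.  A cluster point p of (U_n) lies in C, and a neighbourhood of p in
   C with finite support meets U'_n as soon as it meets U_n, for n large. *)
Lemma clopen_depends_on_finite (J : Type) (T : J -> topologicalType)
    (C : set (prod_topology T)) :
  (forall U : nat -> set (prod_topology T), (forall n, open (U n)) ->
    (forall n, U n !=set0) ->
    exists p : prod_topology T, forall N, nbhs p N ->
      forall m, exists2 n, (m <= n)%N & N `&` U n !=set0) ->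
  clopen C -> exists2 G, finite_set G & depends_on G C.
Proof.
move=> fc [oC cC]; apply: contrapT => nC.
have nG (G : set J) : finite_set G -> exists x y : prod_topology T,
    [/\ forall j, G j -> x j = y j, C x & ~ C y].
  move=> Gfin; apply: contrapT => nxy; apply: nC; exists G => // x y xy Cx.
  by apply: contrapT => nCy; apply: nxy; exists x, y.
have [p0 _] := nG _ (finite_set0 J).
(* [s] packs the next support, an open subset of [C], and a point whose values on the new
   coordinates force points that agree on [G] with that subset out of [C]. For infinite [G] it is
   junk, filled with [p0]. *)
have /choice[step stepP] (G : set J) :
    exists s : set J * set (prod_topology T) * prod_topology T,
    finite_set G -> [/\ finite_set s.1.1, G `<=` s.1.1,
      open s.1.2 /\ s.1.2 !=set0, s.1.2 `<=` C &
      forall z w, s.1.2 z -> (forall j, G j -> w j = z j) ->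
        (forall j, s.1.1 j -> ~ G j -> w j = s.2 j) -> ~ C w].
  have [Gfin|] := pselect (finite_set G); last by exists (set0, set0, p0).
  have [x [y [xy Cx nCy]]] := nG G Gfin.
  have onC : open (~` C) by exact: closed_openC.
  have [H [ O [Hfin oO Oy OC]]] :=
    nbhs_sub_box (open_nbhs_nbhs (conj onC nCy)).
  (* Nonempty because [x] lies in [C] and agrees with [y] on [G]. *)
  pose U := (C `&` [set z | forall j, G j -> O j (z j)])°.
  exists (G `|` H, U, y) => _; split=> /=.
  - by rewrite finite_setU.
  - exact: subsetUl.
  - split; first exact: open_interior.
    exists x; apply: filterI; first exact: open_nbhs_nbhs.
    apply: nbhs_box => // j Gj; apply: open_nbhs_nbhs; split=> //.
    by rewrite xy.
  - by move=> z /interior_subset[].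
  - move=> z w /interior_subset[_ Oz] wz wy.
    apply: OC => j Hj; have [Gj|nGj] := pselect (G j).
      by rewrite wz//; exact: Oz.
    by rewrite wy//; right.
pose G n := iter n (fun G => (step G).1.1) set0.
have Gfin n : finite_set (G n).
  by elim: n => [|n IH] /=; [exact: finite_set0|have [] := stepP _ IH].
have Gmono m n j : (m <= n)%N -> G m j -> G n j.
  move=> /subnK <-; elim: (n - m)%N => // k IH /IH Gk.
  by have [_ + _ _ _] := stepP _ (Gfin (k + m)%N); apply.
pose U n := (step (G n)).1.2.
have [||p pU] := fc U.
- by move=> n; have [_ _ []] := stepP _ (Gfin n).
- by move=> n; have [_ _ []] := stepP _ (Gfin n).
have Cp : C p.
  apply: contrapT => nCp.
  have [|n _ [z [nCz Uz]]] := pU (~` C) _ 0%N.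
    by apply: open_nbhs_nbhs; split=> //; exact: closed_openC.
  by have [_ _ _ UC _] := stepP _ (Gfin n); exact/nCz/UC.
have [H [ O [Hfin oO Op OC]]] := nbhs_sub_box (open_nbhs_nbhs (conj oC Cp)).
(* Coordinates of the finite set [H] that ever enter some [G n] have done so by stage [m]. *)
have [m mP] : exists m, forall j, H j -> (exists n, G n j) -> G m j.
  apply: (@filter_ex _ \oo); apply: (@filter_finite_forall _ _ \oo H
    (fun j => [set m | (exists n, G n j) -> G m j])) => // j _.
  have [[n Gnj]|nGj] := pselect (exists n, G n j); last first.
    by apply: filterE => m /nGj.
  by exists n => // m /= nm _; exact: Gmono Gnj.
have [|n mn [z [Oz Uz]]] := pU [set z | forall j, H j -> O j (z j)] _ m.
  by apply: nbhs_box => // j _; exact: open_nbhs_nbhs.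
have [_ _ _ _ UnC] := stepP _ (Gfin n).
pose y := (step (G n)).2.
(* [w] has the values of [y] on the new coordinates, so it is outside [C]; as n >= m, none of these
   lies in [H], so [w] stays with [z] in the box around [p], inside [C]. *)
pose w : prod_topology T :=
  fun j => if pselect (G n.+1 j /\ ~ G n j) then y j else z j.
apply: (UnC z w) => //.
- by move=> j Gj; rewrite /w; case: pselect => [[]|].

- by move=> j Gj nGj; rewrite /w; case: pselect => [|[]].
- apply: OC => j Hj; rewrite /w; case: pselect => [[Gj []]|nGj] /=;
    last exact: Oz.
  by apply: (Gmono m) => //; apply: mP => //; exists n.+1.
Qed.

(** Each [V n] is taken so small that it misses [U l] for all large [l]. A sparse subsequence is
    then disjoint, and local finiteness passes to it and makes its union closed. *)
Lemma disjoint_clopen_copies (Y : topologicalType) (U : nat -> set Y) :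
  (forall W : set Y, open W -> W !=set0 ->
    exists V, [/\ clopen V, V `<=` W & local_homeo V [set: Y]]) ->
  (forall n, open (U n)) -> (forall n, U n !=set0) ->
  (forall p : Y, exists N m, nbhs p N /\
    forall n x, (m <= n)%N -> N x -> ~ U n x) ->
  exists V : nat -> set Y, [/\ forall n, open (V n), disjoint_family V,
    closed (\bigcup_n V n) & forall n, local_homeo (V n) [set: Y]].
Proof.
move=> copy oU U0 Ulf.
have /choice[V /choice[k Vk]] n : exists (V : set Y) k,
    [/\ clopen V, V `<=` U n, local_homeo V [set: Y] &
        forall l x, (k <= l)%N -> V x -> ~ U l x].
  have [x Unx] := U0 n; have [N [m [xN NU]]] := Ulf x.
  have [||V [cV VNU Vh]] := copy (U n `&` N°).
  - by apply: openI => //; exact: open_interior.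
  - by exists x; split.
  exists V, m; split=> //; first by move=> y /VNU[].
  by move=> l y ml /VNU[_ /interior_subset]; exact: NU.
(* Reaching [k n] gives disjointness; [n.+1] makes the indices increase, so that [i <= idx i]. *)
pose idx i := iter i (fun n => maxn (k n) n.+1) 0%N.
have kidx i j : (i < j)%N -> (k (idx i) <= idx j)%N.
  elim: j => // j IH; rewrite ltnS leq_eqVlt => /predU1P[->|/IH kj] /=.
    exact: leq_maxl.
  by rewrite (leq_trans kj)// (leq_trans _ (leq_maxr _ _)).
have leidx i : (i <= idx i)%N.
  by elim: i => // i IH /=; rewrite (leq_trans _ (leq_maxr _ _)).
have dV i j x : (i < j)%N -> V (idx i) x -> ~ V (idx j) x.
  move=> /kidx kij Vi; have [_ VU _ _] := Vk (idx j); move=> /VU.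
  by have [_ _ _ +] := Vk (idx i); apply.
exists (fun i => V (idx i)); split.
- by move=> i; have [[]] := Vk (idx i).
- move=> i j x Vi Vj; have [ij|ji|//] := ltngtP i j.
    by have := dV _ _ _ ij Vi.
  by have := dV _ _ _ ji Vj.
- rewrite -openC openE => p nVp; have [N [m [pN NU]]] := Ulf p.
  have : nbhs p [set x | forall i, `I_m i -> ~ V (idx i) x].
    apply: (@filter_finite_forall _ _ _ _ (fun i => ~` V (idx i))) => // i _.
    apply: open_nbhs_nbhs; split; last by move=> Vp; apply: nVp; exists i.
    by apply: closed_openC; have [[]] := Vk (idx i).
  apply: filterS2 pN => x Nx nVx [i _ Vix].
  have [im|mi] := ltnP i m; first exact: nVx Vix.
  have [_ VU _ _] := Vk (idx i).
  exact: (NU _ _ (leq_trans mi (leidx i)) Nx (VU _ Vix)).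
- by move=> i; have [] := Vk (idx i).
Qed.

(** [P] and its complement split the factor [i0] into copies of [i1] and [i2], providing the binary
    coordinate. Every nonempty clopen set is compared with one model: the union of the [V n] if a
    locally finite sequence exists, all of [Y] otherwise. *)
Lemma local_homeo_labelled (J I : Type) (lab : J -> I)
    (T : I -> topologicalType) (i0 i1 i2 : I) (P : set (T i0))
    (C D : set (prod_topology (fun j => T (lab j)))) :
  (forall i, infinite_set [set j | lab j = i]) ->
  (forall i (U : set (T i)), open U -> U !=set0 -> exists A i',
    [/\ clopen A, A `<=` U & local_homeo [set: T i'] A]) ->
  clopen P -> local_homeo [set: T i1] P -> local_homeo [set: T i2] (~` P) ->
  clopen C -> clopen D -> C !=set0 -> D !=set0 -> local_homeo C D.
Proof.
set Y := prod_topology _ => labinf TP cP Ph Qh cC cD C0 D0.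
have copy := clopen_copy labinf TP.
have [lf|nlf] := pselect (exists U : nat -> set Y, [/\ forall n, open (U n),
    forall n, U n !=set0 & forall p : Y, exists N m, nbhs p N /\
    forall n x, (m <= n)%N -> N x -> ~ U n x]).
  have [U [oU U0 Ulf]] := lf.
  have [V [oV dV cV Vh]] := disjoint_clopen_copies copy oU U0 Ulf.
  have all_homeo (E : set Y) : clopen E -> E !=set0 ->
      local_homeo E (\bigcup_n V n).
    move=> cE E0; have [W [cW WE Wh]] := copy E (proj1 cE) E0.
    exact: (local_homeo_bigcup_copies oV dV cV Vh cE cW WE Wh).
  apply: (local_homeo_trans (all_homeo C cC C0)).
  exact/local_homeo_sym/all_homeo.
have all_homeo (E : set Y) : clopen E -> E !=set0 -> local_homeo E [set: Y].
  move=> cE E0; have [W [cW WE Wh]] := copy E (proj1 cE) E0.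
  have [|G Gfin GE] := clopen_depends_on_finite _ cE.
    move=> U oU U0; apply: contrapT => np; apply: nlf; exists U; split=> // p.
    apply: contrapT => nN; apply: np; exists p => N pN m.
    apply: contrapT => nn; apply: nN; exists N, m; split=> // n x mn Nx Ux.
    by apply: nn; exists n => //; exists x.
  (* A fresh coordinate exists because infinitely many carry the label [i0] and the support [G] is
     finite; it halves both [E] and [Y]. *)
  have [j /= [labj nGj]] := infinite_setN0 (infinite_setD (labinf i0) Gfin).
  subst i0.
  pose Q := [set y : Y | P (y j)].
  have half (F : set Y) : depends_on G F ->
      local_homeo F (F `&` Q) /\ local_homeo F (F `&` ~` Q).
    move=> GF; split; first exact: (local_homeo_half labinf Gfin nGj Ph GF).
    exact: (local_homeo_half labinf Gfin nGj Qh GF).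
  have [TQ TnQ] := half setT (fun _ _ _ => id).
  have [EQ EnQ] := half E GE.
  apply: (@local_homeo_absorb Y Q E W) => //.
  - exact: (preimage_clopen cP (@prod_coord_continuous J _ j)).
  - by apply: local_homeo_sym; rewrite setTI in TQ.
  - by apply: local_homeo_sym; rewrite setTI in TnQ.
apply: (local_homeo_trans (all_homeo C cC C0)).
exact/local_homeo_sym/all_homeo.
Qed.

(** * The factors of the space *)

Lemma set_val_continuous (T : topologicalType) (A : set T) :
  continuous (set_val : set_type A -> T).
Proof. exact: initial_continuous. Qed.

Lemma set_type_cvg (S T : topologicalType) (A : set T) (f : S -> set_type A)
    (x : S) :
  {for x, continuous (fun y => set_val (f y))} -> {for x, continuous f}.
Proof.
move=> fc V [_ [[W oW <-] Wfx] WV]; apply: filterS WV _.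
exact: (fc W (open_nbhs_nbhs (conj oW Wfx))).
Qed.

Lemma local_homeo_set_type (S T : topologicalType) (A : set S) (B : set T) :
  local_homeo A B -> homeomorphic (set_type A) (set_type B).
Proof.
move=> [f [g [fA gB fc gc]]].
have fB (x : set_type A) : f (set_val x) \in B.
  by apply/mem_set; have [] := fA _ (set_valP x).
have gA (y : set_type B) : g (set_val y) \in A.
  by apply/mem_set; have [] := gB _ (set_valP y).
exists (fun x => SigSub (fB x)), (fun y => SigSub (gA y)); split.
- move=> x; apply: set_type_cvg.
  apply: (@continuous_comp _ _ _ (set_val : set_type A -> S) f).
    exact: set_val_continuous.
  exact: fc (set_valP x).
- move=> y; apply: set_type_cvg.
  apply: (@continuous_comp _ _ _ (set_val : set_type B -> T) g).
    exact: set_val_continuous.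
  exact: gc (set_valP y).
- by move=> x; apply: val_inj => /=; have [] := fA _ (set_valP x).
- by move=> y; apply: val_inj => /=; have [] := gB _ (set_valP y).
Qed.

(** Points outside [B] go to the junk value [b]; near a point of the open set [A] the map [g] is the
    true inverse, hence continuous. *)
Lemma local_homeo_val (T : topologicalType) (A B : set T) :
  open A -> A `<=` B -> B !=set0 ->
  local_homeo (set_val @^-1` A : set (set_type B)) A.
Proof.
move=> oA AB [b Bb].
pose g (x : T) : set_type B :=
  if pselect (B x) is left Bx then SigSub (mem_set Bx) else SigSub (mem_set Bb).
have gE x : B x -> set_val (g x) = x.
  by move=> Bx; rewrite /g; case: pselect.
exists set_val, g; split.
- move=> x Ax; split=> //; apply: val_inj; exact: gE (set_valP x).
- by move=> x Ax; rewrite /= gE//; exact: AB.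
- by move=> x _; exact: set_val_continuous.
- move=> x Ax; apply: set_type_cvg; rewrite /prop_for /continuous_at gE;
    last exact: AB.
  apply: cvg_trans (@cvg_id _ (nbhs x)); apply: near_eq_cvg.
  have := open_nbhs_nbhs (conj oA Ax); apply: filterS => y /AB By.
  by rewrite gE.
Qed.

Lemma local_homeo_singleton (S T : topologicalType) (s : S) (t : T) :
  local_homeo [set s] [set t].
Proof.
by exists (cst t), (cst s); split=> [x ->|x ->|x _|x _]//; exact: cst_continuous.
Qed.

(* [Point] labels a one-point factor: adding such factors does not change the
   product, and makes the proper clopen subsets of [bool] copies of a factor. *)
Inductive factor (X : Type) (Bs : set (set X)) :=
  Point | Bit | Whole | Member of set_type Bs.
Arguments Point {X Bs}.
Arguments Bit {X Bs}.
Arguments Whole {X Bs}.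

Definition factor_space (X : topologicalType) (Bs : set (set X))
    (i : factor Bs) : topologicalType :=
  match i with
  | Point => set_type [set true]
  | Bit => bool
  | Whole => X
  | Member B => set_type (set_val B)
  end.

Lemma local_homeo_point (X : topologicalType) (Bs : set (set X)) (b : bool) :
  local_homeo [set: factor_space (@Point X Bs)] [set b].
Proof.
pose t : set_type [set true] := SigSub (mem_set erefl).
have -> : [set: factor_space (@Point X Bs)] = [set t].
  apply/seteqP; split=> // x _; apply: val_inj => /=.
  exact: (set_valP x).
exact: local_homeo_singleton.
Qed.

Lemma local_homeo_member (X : topologicalType) (Bs : set (set X)) (B : set X)
    (BsB : Bs B) :
  open B -> B !=set0 ->
  local_homeo [set: factor_space (Member (SigSub (mem_set BsB)))] B.
Proof.
move=> oB B0.
rewrite (_ : setT = (set_val @^-1` B : set (set_type B))).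
  exact: local_homeo_val.
by apply/seteqP; split=> x // _; exact: (set_valP x).
Qed.

(** [Bit] shrinks to a singleton and [X] to a member. An open set in a member B is the trace of an
    open W, and W ∩ B, open since B is, contains a member. *)
Lemma factor_space_pi_base (X : topologicalType) (Bs : set (set X)) :
  pi_base Bs -> (forall B : set X, Bs B -> clopen B) ->
  forall (i : factor Bs) (U : set (factor_space i)), open U -> U !=set0 ->
  exists A i', [/\ clopen A, A `<=` U &
    local_homeo [set: factor_space (i' : factor Bs)] A].
Proof.
move=> [Bs0 Bspi] Bscl [|||B] U oU [u Uu].
- exists setT, Point; split; [exact: clopenT| |exact: local_homeo_refl].
  move=> x _; suff -> : x = u by [].
  by apply: val_inj; rewrite (set_valP x) (set_valP u).
- exists [set u], Point; split; [|by move=> _ ->|exact: local_homeo_point].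
  by split; [|rewrite -openC]; exact: (@discrete_open bool).
- have [|V BsV VU] := Bspi U oU; first by exists u.
  exists V, (Member (SigSub (mem_set BsV))); split=> //; first exact: Bscl.
  by have [oV V0] := Bs0 _ BsV; exact: local_homeo_member.
- case: oU Uu => W oW <- Wu.
  have [oB B0] := Bs0 _ (set_valP B).
  have [||V BsV VW] := Bspi (W `&` set_val B).
  + exact: openI.
  + by exists (set_val u); split=> //; exact: set_valP.
  have [oV V0] := Bs0 _ BsV.
  exists (set_val @^-1` V), (Member (SigSub (mem_set BsV))); split.
  + by apply: preimage_clopen; [exact: Bscl|exact: set_val_continuous].
  + by move=> x /VW[].
  + apply: local_homeo_trans (local_homeo_member BsV oV V0) _.
    by apply/local_homeo_sym/local_homeo_val => // x /VW[].
Qed.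

(** * Flattening the power into one labelled product *)

Lemma pair_continuous_at (S T U : topologicalType) (f : S -> T) (g : S -> U)
    (x : S) :
  {for x, continuous f} -> {for x, continuous g} ->
  {for x, continuous (fun y => (f y, g y))}.
Proof.
move=> fc gc A [[P Q] [/= fP gQ] PQA].
apply: (@filterS2 _ _ _ (f @^-1` P) (g @^-1` Q)); last 2 first.
- exact: fc P fP.
- exact: gc Q gQ.
- by move=> y Py Qy; exact: (PQA (f y, g y)).
Qed.

(** Coordinates are regrouped by an index in [K] and a kind of factor; [Point] coordinates carry
    their only value [pt]. *)
Lemma local_homeo_flatten (X : topologicalType) (Bs : set (set X)) (K : Type) :
  exists (f : {ptws K -> (X * bool * prod_family Bs)%type} ->
       prod_topology (fun j : K * factor Bs => factor_space j.2)) g,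
    inverse_homeo setT setT f g.
Proof.
pose Y : topologicalType := {ptws K -> (X * bool * prod_family Bs)%type}.
pose Z : topologicalType :=
  prod_topology (fun j : K * factor Bs => factor_space j.2).
pose pt : set_type [set true] := SigSub (mem_set erefl).
pose f (y : Y) : Z := fun j =>
  match j as j return factor_space j.2 with
  | (_, Point) => pt
  | (k, Bit) => (y k).1.2
  | (k, Whole) => (y k).1.1
  | (k, Member B) => (y k).2 B
  end.
pose g (z : Z) : Y := fun k =>
  (z (k, Whole), z (k, Bit), (fun B => z (k, Member B)) : prod_family Bs).
have yc (k : K) (y : Y) : {for y, continuous (fun y : Y => y k)}.
  exact: prod_coord_continuous.
have zc j (z : Z) : {for z, continuous (fun z : Z => z j)}.
  exact: prod_coord_continuous.
exists f, g; split.
- move=> y _; split=> //; apply: funext => k; rewrite /g /f.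
  by case: (y k) => [[a b] c].
- move=> z _; split=> //; apply: functional_extensionality_dep.
  move=> [k [|||B]] //=; apply: val_inj; exact/esym/(set_valP (z (k, Point))).
- move=> y _; apply: (@prod_cvg _ _ _ _ (fmap_filter _ (@nbhs_filter _ _))).
  move=> [k [|||B]].
  + exact: cvg_cst.
  + apply: (@continuous_comp _ _ _ (fun y : Y => (y k).1) snd).
      apply: (@continuous_comp _ _ _ (fun y : Y => y k) fst) => //.
      exact: cvg_fst.
    exact: cvg_snd.
  + apply: (@continuous_comp _ _ _ (fun y : Y => (y k).1) fst).
      apply: (@continuous_comp _ _ _ (fun y : Y => y k) fst) => //.
      exact: cvg_fst.
    exact: cvg_fst.
  + apply: (@continuous_comp _ _ _ (fun y : Y => (y k).2) (fun c => c B)).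
      apply: (@continuous_comp _ _ _ (fun y : Y => y k) snd) => //.
      exact: cvg_snd.
    exact: prod_coord_continuous.
- move=> z _; apply: (@prod_cvg _ _ _ _ (fmap_filter _ (@nbhs_filter _ _)))
    => k.
  apply: pair_continuous_at; first apply: pair_continuous_at.
  + exact: (zc (k, Whole) z).
  + exact: (zc (k, Bit) z).
  apply: (@prod_cvg _ _ _ _ (fmap_filter _ (@nbhs_filter _ _)))
    => B.
  exact: (zc (k, Member B) z).
Qed.

Theorem theorem15 (X : topologicalType) (Bs : set (set X)) (K : Type) :
  tychonoff_space X ->
  pi_base Bs ->
  (forall B : set X, Bs B -> clopen B) ->
  infinite_set [set: K] ->
  h_homogeneous {ptws K -> (X * bool * prod_family Bs)%type}.
Proof.
move=> _ Bspi Bscl Kinf C D cC cD C0 D0; apply: local_homeo_set_type.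
have [f [g [fT gT fc gc]]] := local_homeo_flatten Bs K.
have flat (E : set {ptws K -> (X * bool * prod_family Bs)%type}) :
    clopen E -> E !=set0 ->
    [/\ clopen (g @^-1` E), g @^-1` E !=set0 & local_homeo E (g @^-1` E)].
  move=> cE [x Ex]; split.
  - by apply: preimage_clopen => // z; exact: gc.
  - by exists (f x); rewrite /= (fT x Logic.I).2.
  - exists f, g; split.
    + by move=> y Ey; rewrite /= (fT y Logic.I).2.
    + by move=> z Ez; rewrite (gT z Logic.I).2.
    + by move=> y _; exact: fc.
    + by move=> z _; exact: gc.
have [gC gC0 Ch] := flat C cC C0; have [gD gD0 Dh] := flat D cD D0.
apply: (local_homeo_trans Ch); apply: local_homeo_trans (local_homeo_sym Dh).
have bit : ~` [set true] = [set false].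
  by apply/seteqP; split=> -[] //= [] //.
(* [Bit] splits into two copies of [Point], and each label occurs once for every element of the
   infinite [K]. *)
apply: (@local_homeo_labelled _ _ snd (@factor_space X Bs) Bit Point Point
  [set true] _ _ _ (factor_space_pi_base Bspi Bscl)) => //.
- move=> i fin; apply: Kinf; apply: sub_finite_set (finite_image fst fin).
  by move=> k _; exists (k, i).
- by split; [|rewrite -openC]; exact: (@discrete_open bool).
- exact: local_homeo_point.
- by rewrite bit; exact: local_homeo_point.
Qed.
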